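(* Let $p$ be a prime. For any integers $l,m,n$ with $0\leq l\leq n$, the $l+1$ vectors $$\sum_{i=0}^{n}\binom{k-i}{l}e_i,\qquad m\leq k\leq m+l,$$ are linearly independent in $\mathbb{F}_p^{n+1}$.
   Context: $e_i$, $0\leq i\leq n$, denotes the $i$th standard basis vector of $\mathbb{F}_p^{n+1}$. For an integer $x$ (possibly negative) and $l\geq0$, $\binom{x}{l}=x(x-1)\cdots(x-l+1)/l!$, an integer, reduced mod $p$. *)

(* Defs.v *)
From HB Require Import structures.
From mathcomp Require Import all_boot all_order all_algebra.

Set Implicit Arguments.
Unset Strict Implicit.
Unset Printing Implicit Defensive.

Import Order.TTheory GRing.Theory Num.Theory.
Local Open Scope ring_scope.

(* Binomial coefficient with an integer (possibly negative) upper argument,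
   x (x - 1) ... (x - l + 1) / l!; the division is exact, see [binzE]. *)
Definition binz (x : int) (l : nat) : int :=
  ((\prod_(j < l) (x - j%:Z)) %/ (l`!)%:Z)%Z.

Lemma prod_nat_bin (a l : nat) :
  \prod_(j < l) (a%:Z - j%:Z) = 'C(a, l)%:Z * (l`!)%:Z.
Proof.
rewrite -PoszM bin_ffact; elim: l => [|l IHl]; first by rewrite big_ord0 ffactn0.
rewrite big_ord_recr /= IHl ffactnSr PoszM.
have [le_la|lt_al] := leqP l a; first by rewrite subzn.
by rewrite ffact_small // !mul0r.
Qed.

Lemma dvdz_fact_prod (x : int) (l : nat) :
  ((l`!)%:Z %| \prod_(j < l) (x - j%:Z))%Z.
Proof.
case: (intP x) => [|a|a].
- by rewrite prod_nat_bin dvdz_mull.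
- by rewrite prod_nat_bin dvdz_mull.
have -> : \prod_(j < l) (- a.+1%:Z - j%:Z)
    = (-1) ^+ l * \prod_(j < l) ((a + l)%N%:Z - j%:Z).
  rewrite [X in _ = _ * X](reindex_inj rev_ord_inj) /=.
  rewrite -[X in (-1) ^+ X]card_ord -prodrN.
  apply: eq_bigr => j _; rewrite -opprD; congr (- _).
  rewrite subzn; last by rewrite (leq_trans (leq_subr _ _)) ?leq_addl.
  by rewrite -PoszD -addnBA ?leq_subr // subKn // addnS addSn.
by rewrite prod_nat_bin mulrA dvdz_mull.
Qed.

Lemma binzE (x : int) (l : nat) :
  binz x l * (l`!)%:Z = \prod_(j < l) (x - j%:Z).
Proof. exact/divzK/dvdz_fact_prod. Qed.

(* The vector \sum_i binom(k - i, l) e_i of F_p^{n+1}; the standard basis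
   vector e_i is [delta_mx 0 i]. *)
Definition binvec (p n l : nat) (k : int) : 'rV['F_p]_n.+1 :=
  \sum_(i < n.+1) (binz (k - i%:Z) l)%:~R *: delta_mx 0 i.

(* Main.v *)
Require Import Defs.
From HB Require Import structures.
From mathcomp Require Import all_boot all_order all_algebra.

Set Implicit Arguments.
Unset Strict Implicit.
Unset Printing Implicit Defensive.

Import Order.TTheory GRing.Theory Num.Theory.
Local Open Scope ring_scope.

(** A linear relation with coefficients [c j] between the given vectors says
    that the function [f x = \sum_j c j * binom(x + j, l)], from the integers
    to the field, vanishes at the points [m - i] for [0 <= i <= n], among which
    are [l + 1] consecutive ones since [l <= n].  By Pascal's rule the forward
    difference of [f] is the same combination with [l - 1] in place of [l], so
    [f] behaves like a polynomial function of degree at most [l]: vanishing at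
    [l + 1] consecutive integers forces it to vanish everywhere
    ([bin_comb_eq0]).  This is a characteristic-free argument, as it never
    divides by [l!].

    The relation therefore holds at every integer [x], whatever [m] is, and one
    may evaluate it at [x = 0, ..., l].  There the matrix [binom(x + j, l)] is
    zero for [x + j < l] and one for [x + j = l], that is, anti-triangular with
    unit antidiagonal, so all the [c j] vanish ([bin_comb_coef0]). *)

Lemma binz_nat (a l : nat) : binz a%:Z l = 'C(a, l)%:Z.
Proof.
have fact_neq0 : (l`!)%:Z != 0 by rewrite eqz_nat -lt0n fact_gt0.
by apply: (mulIf fact_neq0); rewrite binzE prod_nat_bin.
Qed.

Lemma binz0 (x : int) : binz x 0 = 1.
Proof. by rewrite /binz big_ord0 divz1. Qed.

(** Pascal's rule survives for negative upper arguments: after clearing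
    [(l + 1)!], both sides are [\prod_(j < l) (x - j)] times a linear factor,
    and [x + 1 = (x - l) + (l + 1)]. *)
Lemma binzS (x : int) (l : nat) :
  binz (x + 1) l.+1 = binz x l.+1 + binz x l.
Proof.
have fact_neq0 : (l.+1`!)%:Z != 0 by rewrite eqz_nat -lt0n fact_gt0.
apply: (mulIf fact_neq0); rewrite mulrDl !binzE.
rewrite big_ord_recl big_ord_recr /= subr0 factS PoszM mulrCA binzE.
under eq_bigr => j _ do rewrite /bump /= PoszD opprD addrA addrK.
by rewrite (mulrC l.+1%:Z) -mulrDr mulrC -addn1 PoszD addrA subrK.
Qed.

Section BinomialCombinations.

Variables (R : pzRingType) (I : finType) (c : I -> R) (s : I -> int).

(** Arbitrary shifts [s] make the family, indexed by [l], stable under the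
    forward difference, which turns [l.+1] into [l]; this is what lets the
    induction on [l] go through.  The difference of the function vanishes at
    one point fewer, so it is zero by induction, and the function is constant. *)
Lemma bin_comb_eq0 (l : nat) (a : int) :
    (forall t : nat, (t <= l)%N ->
       \sum_i c i * (binz (a + t%:Z + s i) l)%:~R = 0) ->
  forall x, \sum_i c i * (binz (x + s i) l)%:~R = 0.
Proof.
elim: l => [|l IHl] in a *.
  move=> /(_ 0 isT) f0 x; rewrite -[RHS]f0.
  by apply: eq_bigr => i _; rewrite !binz0.
pose f l x := \sum_i c i * (binz (x + s i) l)%:~R.
rewrite -/(f l.+1 _) => fa0.
have diff_f x : f l.+1 (x + 1) = f l.+1 x + f l x.
  rewrite -big_split; apply: eq_bigr => i _ /=.
  by rewrite addrAC binzS intrD mulrDr.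
have fl0 : forall x, f l x = 0.
  apply: (IHl a) => t le_tl.
  have := diff_f (a + t%:Z).
  rewrite -addrA -PoszD addn1 /f !fa0 // ?ltnS ?(leqW le_tl) //.
  by rewrite add0r.
have step x : f l.+1 (x + 1) = f l.+1 x by rewrite diff_f fl0 addr0.
have const_up y t : f l.+1 (y + t%:Z) = f l.+1 y.
  by elim: t => [|t IHt]; rewrite ?addr0 // -[t.+1]addn1 PoszD addrA step.
have f_a : f l.+1 a = 0 by have := fa0 0 isT; rewrite addr0.
move=> x; rewrite -/(f l.+1 x) -f_a.
have [le_ax|/ltW le_xa] := leP a x.
  by rewrite -(subrKC a x) -[x - a]gez0_abs ?subr_ge0 // const_up.
by rewrite -[in RHS](subrKC x a) -[a - x]gez0_abs ?subr_ge0 // const_up.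
Qed.

End BinomialCombinations.

(** Evaluating at [x = l - j] kills the terms of index below [j], whose binomial
    coefficient is zero; those of index above [j] are killed by downward
    induction, and [c j] remains with coefficient [binom(l, l) = 1]. *)
Lemma bin_comb_coef0 (R : pzRingType) (l : nat) (c : 'I_l.+1 -> R) :
    (forall x, \sum_j c j * (binz (x + j%:Z) l)%:~R = 0) ->
  forall j, c j = 0.
Proof.
move=> f0 j; have [k] := ubnP (l - j)%N; elim: k j => // k IHk j lt_k.
have le_jl : (j <= l)%N by rewrite -ltnS.
have := f0 (l - j)%N%:Z; rewrite (bigD1 j) //= -PoszD subnK // binz_nat binn.
rewrite mulr1 big1 ?addr0 // => i neq_ij.
have [lt_ij|le_ji] := ltnP i j.
  rewrite -PoszD binz_nat bin_small ?mulr0 //.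
  by rewrite -[X in (_ < X)%N](subnK le_jl) ltn_add2l.
have lt_ji : (j < i)%N by rewrite ltn_neqAle eq_sym neq_ij.
have lt_jl : (j < l)%N by rewrite (leq_trans lt_ji) // -ltnS.
by rewrite IHk ?mul0r // -ltnS (leq_trans _ lt_k) // ltnS ltn_sub2l.
Qed.

Lemma binvecE (p n l : nat) (k : int) (i : 'I_n.+1) :
  binvec p n l k 0 i = (binz (k - i%:Z) l)%:~R.
Proof.
rewrite summxE (bigD1 i) //= !mxE !eqxx mulr1 big1 ?addr0 // => j neq_ji.
by rewrite !mxE eq_sym (negPf neq_ji) andbF mulr0.
Qed.

Theorem proposition1p2 (p : nat) (p_prime : prime p)
    (l n : nat) (m : int) (le_ln : (l <= n)%N) :
  free [seq binvec p n l (m + j%:Z) | j <- iota 0 l.+1].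
Proof.
pose v j := binvec p n l (m + j%:Z).
suff: free (map_tuple v (iota_tuple l.+1 0)) by [].
apply/freeP => c c0.
apply: bin_comb_coef0; apply: (bin_comb_eq0 (a := m - l%:Z)) => t le_tl.
(* The coordinate of index [l - t] of the relation is its value at
   [m - l + t]. *)
have lt_n : (l - t < n.+1)%N by rewrite ltnS (leq_trans (leq_subr _ _)).
have := congr1 (fun u : 'rV_n.+1 => u 0 (Ordinal lt_n)) c0.
rewrite summxE mxE => c0i; rewrite -[RHS]c0i; apply: eq_bigr => j _.
rewrite mxE (nth_map 0%N) ?size_iota // nth_iota // binvecE /= add0n.
by rewrite -subzn // opprB [in RHS]addrAC [t%:Z - _]addrC addrA.
Qed.
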